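(* Let $0<a,b<1$ be real numbers with $b\le 2a$ and $a\le 2b$, and let $g$ be the Nim value function of $G(S)$ for $S=\{a,b,1\}$. Exchanging $a$ and $b$ if necessary, assume $a\le b$. **Regions.** Let $n$ be a nonnegative integer and assume that $na+nb<1\le(n+1)a+(n+1)b$. The regions are defined by $$\begin{aligned} (n+1)a+nb\le 1&\le na+(n+1)b &&(n\text{th green region }G_n,\ n\ge1),\\ na+(n+1)b<1&\le (n+1)a+(n+1)b &&(n\text{th red region }R_n,\ n\ge0),\\ na+nb<1&<(n-1)a+(n+1)b &&(n\text{th white region }W_n,\ n\ge1),\\ (n-1)a+(n+1)b\le1&<(n+1)a+nb &&(n\text{th blue region }B_n,\ n\ge1). \end{aligned}$$ **Periods.** If $(a,b)$ lies in a green, red or blue region, then $g$ is purely periodic, and its minimum pure period is $$\begin{cases} a+b & \text{if }(a,b)\text{ is in a green region},\\ a+1 & \text{if }(a,b)\text{ is in a red region},\\ b+1 & \text{if }(a,b)\text{ is in a blue region}.\end{cases}$$ If $(a,b)$ lies in a white region, then $g$ is not purely periodic with the period $a+b$, nor with $1+a$, nor with $1+b$. **Splitting of the regions.** Each $R_n$ is split into two parts, each $W_n$ into four, and each $B_n$ into three, as follows: $$\begin{aligned} na+(n+1)b<1&\le(n+2)a+nb &&(R_n^1),\\ (n+2)a+nb<1&\le(n+1)a+(n+1)b &&(R_n^2); \end{aligned}$$ $$\begin{aligned} na+nb<1&\le\min\bigl((n-1)a+(n+1)b,\ (n+3)a+(n-2)b\bigr) &&(W_n^1),\\ (n+3)a+(n-2)b<1&<(n-1)a+(n+1)b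 &&(W_n^2),\\ na+nb<1&\le(n+2)a+(n-1)b<(n-1)a+(n+1)b &&(W_n^3),\\ (n+2)a+(n-1)b<1&<(n-1)a+(n+1)b &&(W_n^4); \end{aligned}$$ $$\begin{aligned} (n-1)a+(n+1)b\le1&<(n+3)a+(n-2)b &&(B_n^1),\\ \max\bigl((n-1)a+(n+1)b,\ (n+3)a+(n-2)b\bigr)\le1&<(n+2)a+(n-1)b &&(B_n^2),\\ \max\bigl((n-1)a+(n+1)b,\ (n+2)a+(n-1)b\bigr)\le1&<(n+1)a+nb &&(B_n^3). \end{aligned}$$ **The remainder $\lambda$.** Let $m=a+b$ and let $\lambda$ be the remainder when $1-a$ is divided by $m$, i.e. $\lambda=1-a-\left\lfloor\frac{1-a}{m}\right\rfloor m$. Then $\lambda$ determines the ''color'' (the region) of $(a,b)$ as follows: $$\begin{aligned} 0\le\lambda&\le b-a &&(G_n),\\ b-a<\lambda&\le a &&(R_n^1),\\ a<\lambda&\le b &&(R_n^2),\\ b<\lambda&<\min(2b-a,\,3a-b) &&(W_n^1),\\ 3a-b\le\lambda&<2b-a &&(W_n^2),\\ b<\lambda&<2a<2b-a &&(W_n^3),\\ 2a\le\lambda&<2b-a &&(W_n^4),\\ 2b-a\le\lambda&<3a-b &&(B_n^1),\\ \max(2b-a,\,3a-b)\le\lambda&<2a &&(B_n^2),\\ \max(2b-a,\,2a)\le\lambda&<a+b=m &&(B_n^3). \end{aligned}$$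
   Context: For a nonempty finite set $S\subset\mathbb{R}_{>0}$, the Continim $G(S)$ is the impartial game under normal play (a player who cannot move loses) whose positions are the real numbers $x\ge 0$ and whose moves are $x\mapsto x-s$ with $s\in S$, $s\le x$. Its Nim value function $g_S:\mathbb{R}_{\ge0}\to\mathbb{Z}_{\ge0}$ is given by $g_S(x)=\operatorname{mex}\{g_S(x-s)\mid s\in S,\ s\le x\}$, where $\operatorname{mex}A$ is the least nonnegative integer not in $A$. (The case $a=b$, in which $S=\{a,1\}$, is included.) A function $f:\mathbb{R}_{\ge0}\to\mathbb{Z}_{\ge0}$ is purely periodic with (pure) period $p>0$ if $f(x+p)=f(x)$ for all $x\ge 0$; the minimum pure period is the smallest such $p>0$.
   Formalization: The printed tables conflict on boundaries: the λ rows for W^1, W^2 are proved for λ≠3a−b, those for W^3, W^4 for λ≠2a; b<λ is added to the W^2 and B^1 rows; W^1 omits the blue line 1=(n−1)a+(n+1)b; W^2 is not claimed disjoint from W^3, W^4, with which it overlaps. *)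

(* Defs.v *)
From Stdlib Require Import Reals ZArith Lra Lia List.
Open Scope R_scope.

(** * The game G(S)

    A finite set [S] of positive reals is given by a list of its elements;
    order and repetitions in the list play no role. *)

Definition move (S : list R) (x y : R) : Prop :=
  exists s, In s S /\ s <= x /\ y = x - s.

Definition is_mex (A : nat -> Prop) (k : nat) : Prop :=
  ~ A k /\ forall j, (j < k)%nat -> A j.

(** Positions are the reals [x >= 0]: the values of [g] at negative reals
    are irrelevant.  On the positions the recursion determines [g], see
    [nim_value_exists] and [nim_value_unique] below. *)
Definition nim_value (S : list R) (g : R -> nat) : Prop :=
  forall x, 0 <= x -> is_mex (fun v => exists y, move S x y /\ v = g y) (g x).

Definition pure_period (f : R -> nat) (p : R) : Prop :=
  0 < p /\ forall x, 0 <= x -> f (x + p) = f x.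

Definition purely_periodic (f : R -> nat) : Prop :=
  exists p, pure_period f p.

Definition min_pure_period (f : R -> nat) (p : R) : Prop :=
  pure_period f p /\ forall q, pure_period f q -> p <= q.

(** * Regions

    The coefficients [n - 1] and [n - 2] are integers (so [-1] is possible),
    hence the subtractions take place in [R], not in [nat]. *)

Definition level (n : nat) (a b : R) : Prop :=
  INR n * a + INR n * b < 1 <= (INR n + 1) * a + (INR n + 1) * b.

Definition green (n : nat) (a b : R) : Prop :=
  (1 <= n)%nat /\
  (INR n + 1) * a + INR n * b <= 1 <= INR n * a + (INR n + 1) * b.

Definition red (n : nat) (a b : R) : Prop :=
  INR n * a + (INR n + 1) * b < 1 <= (INR n + 1) * a + (INR n + 1) * b.

Definition white (n : nat) (a b : R) : Prop :=
  (1 <= n)%nat /\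
  INR n * a + INR n * b < 1 < (INR n - 1) * a + (INR n + 1) * b.

Definition blue (n : nat) (a b : R) : Prop :=
  (1 <= n)%nat /\
  (INR n - 1) * a + (INR n + 1) * b <= 1 < (INR n + 1) * a + INR n * b.

(** The parts of a region are by definition subsets of it.  This matters for
    [white1], whose own inequalities also allow
    [1 = (n - 1) * a + (n + 1) * b], a line that belongs to [blue]. *)

Definition red1 (n : nat) (a b : R) : Prop :=
  red n a b /\
  INR n * a + (INR n + 1) * b < 1 <= (INR n + 2) * a + INR n * b.

Definition red2 (n : nat) (a b : R) : Prop :=
  red n a b /\
  (INR n + 2) * a + INR n * b < 1 <= (INR n + 1) * a + (INR n + 1) * b.

Definition white1 (n : nat) (a b : R) : Prop :=
  white n a b /\
  INR n * a + INR n * b < 1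
    <= Rmin ((INR n - 1) * a + (INR n + 1) * b)
            ((INR n + 3) * a + (INR n - 2) * b).

Definition white2 (n : nat) (a b : R) : Prop :=
  white n a b /\
  (INR n + 3) * a + (INR n - 2) * b < 1 < (INR n - 1) * a + (INR n + 1) * b.

Definition white3 (n : nat) (a b : R) : Prop :=
  white n a b /\
  INR n * a + INR n * b < 1 <= (INR n + 2) * a + (INR n - 1) * b /\
  (INR n + 2) * a + (INR n - 1) * b < (INR n - 1) * a + (INR n + 1) * b.

Definition white4 (n : nat) (a b : R) : Prop :=
  white n a b /\
  (INR n + 2) * a + (INR n - 1) * b < 1 < (INR n - 1) * a + (INR n + 1) * b.

Definition blue1 (n : nat) (a b : R) : Prop :=
  blue n a b /\
  (INR n - 1) * a + (INR n + 1) * b <= 1 < (INR n + 3) * a + (INR n - 2) * b.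

Definition blue2 (n : nat) (a b : R) : Prop :=
  blue n a b /\
  Rmax ((INR n - 1) * a + (INR n + 1) * b)
       ((INR n + 3) * a + (INR n - 2) * b)
    <= 1 < (INR n + 2) * a + (INR n - 1) * b.

Definition blue3 (n : nat) (a b : R) : Prop :=
  blue n a b /\
  Rmax ((INR n - 1) * a + (INR n + 1) * b)
       ((INR n + 2) * a + (INR n - 1) * b)
    <= 1 < (INR n + 1) * a + INR n * b.

(** [Int_part] is the floor. *)
Definition remainder (x m : R) : R := x - IZR (Int_part (x / m)) * m.

(** * Existence and uniqueness of the Nim value function *)

Lemma is_mex_unique (A : nat -> Prop) (k l : nat) :
  is_mex A k -> is_mex A l -> k = l.
Proof.
intros [H1 H2] [H3 H4].
destruct (Nat.lt_total k l) as [H | [H | H]]; auto; exfalso; auto.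
Qed.

Lemma is_mex_ext (A B : nat -> Prop) (k : nat) :
  (forall v, A v <-> B v) -> is_mex A k -> is_mex B k.
Proof. intros E [H1 H2]; split; [rewrite <- E | intros; apply E]; auto. Qed.

Lemma mex_list (l : list nat) : {k | is_mex (fun v => In v l) k}.
Proof.
assert (H : forall d n, (forall j, (j < n)%nat -> In j l) ->
  (length l < n + d)%nat -> {k | is_mex (fun v => In v l) k}).
{ induction d as [|d IH]; intros n Hn Hd.
  - exfalso.
    assert (L : (length (seq 0 n) <= length l)%nat).
    { apply NoDup_incl_length; [apply seq_NoDup|].
      intros j Hj; apply in_seq in Hj; apply Hn; lia. }
    rewrite length_seq in L; lia.
  - destruct (in_dec Nat.eq_dec n l) as [I | I].
    + apply (IH (S n)); [|lia].
      intros j Hj; destruct (Nat.eq_dec j n); [subst; auto | apply Hn; lia].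
    + exists n; split; auto. }
apply (H (S (length l)) O); intros; lia.
Qed.

Definition mex (l : list nat) : nat := proj1_sig (mex_list l).

Fixpoint nim_fuel (k : nat) (S : list R) (x : R) : nat :=
  match k with
  | O => O
  | Datatypes.S k' =>
      mex (map (fun s => nim_fuel k' S (x - s))
               (filter (fun s => if Rle_dec s x then true else false) S))
  end.

Lemma nim_fuel_stable (S : list R) (d : R) :
  (forall s, In s S -> d <= s) ->
  forall k l x, 0 <= x -> x < INR k * d -> x < INR l * d ->
  nim_fuel k S x = nim_fuel l S x.
Proof.
intros HS; induction k as [|k IH]; intros l x Hx Hk Hl.
- simpl in Hk; lra.
- destruct l as [|l]; [simpl in Hl; lra|].
  rewrite S_INR in Hk, Hl; simpl; f_equal; apply map_ext_in.
  intros s Hs; apply filter_In in Hs; destruct Hs as [Hs Hle].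
  destruct (Rle_dec s x); [|discriminate].
  specialize (HS s Hs); apply IH; lra.
Qed.

Lemma list_pos_lower_bound (S : list R) :
  (forall s, In s S -> 0 < s) ->
  exists d, 0 < d /\ forall s, In s S -> d <= s.
Proof.
induction S as [|t S IH]; intros H.
- exists 1; split; [lra | intros s []].
- destruct IH as [d [Hd Hm]]; [intros; apply H; right; auto|].
  exists (Rmin t d); split.
  + apply Rmin_glb_lt; auto; apply H; left; auto.
  + intros s [E | I].
    * subst; apply Rmin_l.
    * apply Rle_trans with d; [apply Rmin_r | auto].
Qed.

Lemma nim_value_exists (S : list R) :
  (forall s, In s S -> 0 < s) -> exists g, nim_value S g.
Proof.
intros HS; destruct (list_pos_lower_bound S HS) as [d [Hd Hm]].
set (N := fun x => Z.to_nat (up (x / d))).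
assert (HN : forall x, 0 <= x -> x < INR (N x) * d).
{ intros x Hx; unfold N.
  destruct (archimed (x / d)) as [U _].
  assert (0 <= x / d) by (apply Rle_mult_inv_pos; lra).
  assert (0 <= up (x / d))%Z by (apply le_IZR; lra).
  rewrite INR_IZR_INZ, Z2Nat.id by auto.
  apply (Rmult_lt_compat_r d) in U; auto.
  replace (x / d * d) with x in U by (field; lra); lra. }
exists (fun x => nim_fuel (N x) S x); intros x Hx.
pose proof (HN x Hx) as Hk; destruct (N x) as [|k]; [simpl in Hk; lra|].
cbn [nim_fuel]; unfold mex.
match goal with |- context [mex_list ?l] => destruct (mex_list l) as [v Hv] end.
cbn [proj1_sig]; revert Hv; apply is_mex_ext; intros w; rewrite in_map_iff.
rewrite S_INR in Hk.
assert (E : forall s, In s S -> s <= x ->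
  nim_fuel k S (x - s) = nim_fuel (N (x - s)) S (x - s)).
{ intros s Hs Hle; pose proof (Hm s Hs).
  apply nim_fuel_stable with d; auto; try lra; apply HN; lra. }
split.
- intros [s [Hw Hs]]; apply filter_In in Hs; destruct Hs as [Hs Hle].
  destruct (Rle_dec s x); [|discriminate].
  exists (x - s); split; [exists s; auto | rewrite <- E; auto].
- intros [y [[s [Hs [Hle Hy]]] Hw]]; subst y; exists s; split.
  + rewrite E; auto.
  + apply filter_In; split; auto; destruct (Rle_dec s x); auto.
Qed.

Lemma nim_value_unique (S : list R) (g h : R -> nat) :
  (forall s, In s S -> 0 < s) -> nim_value S g -> nim_value S h ->
  forall x, 0 <= x -> g x = h x.
Proof.
intros HS Hg Hh; destruct (list_pos_lower_bound S HS) as [d [Hd Hm]].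
assert (H : forall k x, 0 <= x -> x < INR k * d -> g x = h x).
{ induction k as [|k IH]; intros x Hx Hk; [simpl in Hk; lra|].
  rewrite S_INR in Hk.
  apply (is_mex_unique _ _ _ (Hg x Hx)).
  generalize (Hh x Hx); apply is_mex_ext; intros v.
  split; intros [y [[s [Hs [Hle Hy]]] Hv]]; subst; exists (x - s);
    (split; [exists s; auto|]); pose proof (Hm s Hs);
    [symmetry|]; apply IH; lra. }
intros x Hx; destruct (INR_unbounded (x / d)) as [k Hk].
apply (H k x Hx).
apply (Rmult_lt_compat_r d) in Hk; auto.
replace (x / d * d) with x in Hk by (field; lra); exact Hk.
Qed.

(* Main.v *)
Require Import Defs.
From Stdlib Require Import Reals List.
From Stdlib Require Import ZArith Lra Lia.
Import ListNotations.
Open Scope R_scope.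

(** Write [m = a + b].  The game with the moves [a] and [b] alone has period [m]:
    its value is [0] on [[0, a)], [1] on [[a, 2 * a)] and [2] on [[2 * a, m)]
    ([ab_value]).  The colors say where [1] lies modulo [m]: in [(0, b - a)] for
    white, [[b - a, a)] for blue, [[a, b]] for green and [(b, m]] for red.

    Green: a step by any length in [[a, b]] modulo [m] changes the value
    ([ab_value_neq]).  So the additional move [1] alters nothing and
    [g = ab_value].

    Other colors: [g = ab_value] on [[0, 1)], and on [[1, 1 + a)] the move [1]
    leads to zeros, which raises every value by one:
    [g x = ab_value (x - a) + 1] ([ab_value_after_1]).  For red, these values
    repeat with period [1 + a].  For blue, the interval [[1 + a, 1 + b)] carries
    the values [2] and [3], and the whole repeats with period [1 + b].  By
    [nim_value_periodic_extension], the repetition is a Nim value function if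
    the moves across the end of a period change the value; uniqueness
    identifies it with [g].  For white, a few values of [g] near [1] refute the
    three candidates ([white_not_period]).

    Minimality: a period [q] below the claimed one is a multiple of [m], because
    it moves the initial block of zeros onto a block of zeros
    ([period_is_multiple]).  This is absurd for green; for red and blue, [g] is
    positive on [[1, 1 + a)] although some point there lies in [[0, a)] modulo
    [m], so a multiple of [m] would move a zero below [1] to a nonzero value
    ([multiple_not_period]).

    Finally, [n * m < 1 <= (n + 1) * m] leaves two possible quotients for the
    division of [1 - a] by [m], namely [n] and [n - 1]
    ([level_remainder]).  With [lambda] expressed in terms of [n], the regions
    and their parts become linear inequalities. *)

(** * Remainders *)

Ltac zlra := rewrite ?minus_IZR, ?plus_IZR in *; lra.

Lemma remainder_spec (x m : R) :
  0 < m -> exists k, remainder x m = x - IZR k * m /\ 0 <= remainder x m < m.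
Proof.
intros Hm; exists (Int_part (x / m)); split; [reflexivity|]; unfold remainder.
destruct (base_Int_part (x / m)) as [H1 H2].
assert (E : x = x / m * m) by (field; lra).
apply (Rmult_le_compat_r m) in H1; [|lra].
assert (H3 : x / m < IZR (Int_part (x / m)) + 1) by lra.
apply (Rmult_lt_compat_r m) in H3; lra.
Qed.

Lemma multiple_lt (j k : Z) (m : R) :
  0 < m -> IZR j * m < IZR k * m + m -> (j <= k)%Z.
Proof.
intros Hm H; apply Z.lt_succ_r, lt_IZR; rewrite succ_IZR.
apply Rmult_lt_reg_r with m; lra.
Qed.

Lemma remainder_unique (k : Z) (x m : R) :
  IZR k * m <= x < IZR k * m + m -> remainder x m = x - IZR k * m.
Proof.
intros H; assert (Hm : 0 < m) by lra.
destruct (remainder_spec x m Hm) as [l [E Hl]]; rewrite E in *.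
assert (l <= k)%Z by (apply multiple_lt with m; lra).
assert (k <= l)%Z by (apply multiple_lt with m; lra).
replace l with k by lia; reflexivity.
Qed.

Lemma remainder_add_period (x m : R) :
  0 < m -> remainder (x + m) m = remainder x m.
Proof.
intros Hm; destruct (remainder_spec x m Hm) as [k [E Hk]].
rewrite (remainder_unique (k + 1)); zlra.
Qed.

Lemma remainder_small (x m : R) : 0 <= x < m -> remainder x m = x.
Proof. intros H; rewrite (remainder_unique 0); lra. Qed.

(** * Nim values of a game *)

Lemma is_mex_options3 (a b c x : R) (f : R -> nat) (k : nat) :
  (a <= x -> f (x - a) <> k) ->
  (b <= x -> f (x - b) <> k) ->
  (c <= x -> f (x - c) <> k) ->
  (forall j, (j < k)%nat ->
     (a <= x /\ f (x - a) = j) \/ (b <= x /\ f (x - b) = j) \/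
     (c <= x /\ f (x - c) = j)) ->
  is_mex (fun v => exists y, move [a; b; c] x y /\ v = f y) k.
Proof.
intros Ha Hb Hc Hr; split.
- intros [y [[s [Hs [Hle Hy]]] Hk]]; subst y.
  destruct Hs as [E | [E | [E | []]]]; subst s; symmetry in Hk;
    [apply Ha | apply Hb | apply Hc]; auto.
- intros j Hj; destruct (Hr j Hj) as [[H E] | [[H E] | [H E]]].
  + exists (x - a); split; [exists a; simpl; auto | auto].
  + exists (x - b); split; [exists b; simpl; auto | auto].
  + exists (x - c); split; [exists c; simpl; auto | auto].
Qed.

Lemma nim_value_move_neq (S : list R) (g : R -> nat) (x s : R) :
  nim_value S g -> In s S -> 0 <= s <= x -> g (x - s) <> g x.
Proof.
intros Hg Hs Hx E; assert (H0 : 0 <= x) by lra.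
destruct (Hg x H0) as [N _]; apply N.
exists (x - s); split; [exists s; intuition lra | auto].
Qed.

(** Options of a position lie below it, so the recursion determines [g] on an
    initial segment as soon as it is known to hold there. *)
Lemma nim_value_unique_below (S : list R) (g f : R -> nat) (c : R) :
  (forall s, In s S -> 0 < s) -> nim_value S g ->
  (forall x, 0 <= x < c ->
     is_mex (fun v => exists y, move S x y /\ v = f y) (f x)) ->
  forall x, 0 <= x < c -> g x = f x.
Proof.
intros HS Hg Hf; destruct (list_pos_lower_bound S HS) as [d [Hd Hm]].
assert (H : forall k x, 0 <= x < c -> x < INR k * d -> g x = f x).
{ induction k as [|k IH]; intros x Hx Hk; [simpl in Hk; lra|].
  rewrite S_INR in Hk.
  apply (is_mex_unique _ _ _ (Hg x (proj1 Hx))).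
  generalize (Hf x Hx); apply is_mex_ext; intros v.
  split; intros [y [[s [Hs [Hle Hy]]] Hv]]; subst; exists (x - s);
    (split; [exists s; auto|]); pose proof (Hm s Hs);
    [symmetry|]; apply IH; lra. }
intros x Hx; destruct (INR_unbounded (x / d)) as [k Hk].
apply (H k x Hx).
apply (Rmult_lt_compat_r d) in Hk; auto.
replace (x / d * d) with x in Hk by (field; lra); exact Hk.
Qed.

(** A smaller value is reached from [x] by the same move as from the remainder
    of [x], so the later periods only need that the moves crossing a multiple
    of [p] do not hit the value itself. *)
Lemma nim_value_periodic_extension (S : list R) (F : R -> nat) (p : R) :
  0 < p -> (forall s, In s S -> 0 < s <= p) ->
  (forall t, 0 <= t < p ->
     is_mex (fun v => exists y, move S t y /\ v = F y) (F t)) ->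
  (forall t s, In s S -> 0 <= t < s -> F (t - s + p) <> F t) ->
  nim_value S (fun x => F (remainder x p)).
Proof.
intros Hp HS Hmex Hwrap x Hx.
destruct (remainder_spec x p Hp) as [k [E Hk]].
set (t := remainder x p) in *.
assert (Hkx : 0 <= IZR k * p).
{ apply Rmult_le_pos; [|lra]; apply IZR_le.
  apply (multiple_lt 0 k p); lra. }
assert (Hsub : forall s, s <= t -> 0 < s -> remainder (x - s) p = t - s).
{ intros s Hs Hs0; rewrite (remainder_unique k); lra. }
destruct (Hmex t Hk) as [Hnot Hreach]; split.
- intros [y [[s [Hs [Hle Hy]]] Hv]]; subst y.
  destruct (HS s Hs); destruct (Rle_lt_dec s t) as [Hst | Hst].
  + rewrite Hsub in Hv by lra.
    apply Hnot; exists (t - s); split; [exists s; auto | auto].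
  + apply (Hwrap t s Hs); [lra|]; rewrite Hv; f_equal.
    rewrite (remainder_unique (k - 1)); zlra.
- intros j Hj; destruct (Hreach j Hj) as [y [[s [Hs [Hle Hy]]] Hv]]; subst.
  destruct (HS s Hs); exists (x - s); split.
  + exists s; split; [auto | split; lra].
  + rewrite Hsub by lra; reflexivity.
Qed.

(** * The game with moves a and b *)

(** The Nim value function of the game with the two moves [a <= b <= 2 * a],
    extended with its period [a + b] to all reals. *)
Definition ab_value (a b x : R) : nat :=
  let u := remainder x (a + b) in
  if Rlt_dec u a then 0 else if Rlt_dec u (2 * a) then 1 else 2.

Lemma ab_value_0 (a b : R) (k : Z) (x : R) :
  0 < a -> a <= b <= 2 * a ->
  IZR k * (a + b) <= x < IZR k * (a + b) + a -> ab_value a b x = 0%nat.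
Proof.
intros Ha Hb Hx; unfold ab_value; rewrite (remainder_unique k) by lra.
destruct (Rlt_dec _ a); [reflexivity | lra].
Qed.

Lemma ab_value_1 (a b : R) (k : Z) (x : R) :
  0 < a -> a <= b <= 2 * a ->
  IZR k * (a + b) + a <= x < IZR k * (a + b) + 2 * a ->
  ab_value a b x = 1%nat.
Proof.
intros Ha Hb Hx; unfold ab_value; rewrite (remainder_unique k) by lra.
destruct (Rlt_dec _ a); [lra|]; destruct (Rlt_dec _ (2 * a)); [reflexivity | lra].
Qed.

Lemma ab_value_2 (a b : R) (k : Z) (x : R) :
  0 < a -> a <= b <= 2 * a ->
  IZR k * (a + b) + 2 * a <= x < IZR k * (a + b) + (a + b) ->
  ab_value a b x = 2%nat.
Proof.
intros Ha Hb Hx; unfold ab_value; rewrite (remainder_unique k) by lra.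
destruct (Rlt_dec _ a); [lra|]; destruct (Rlt_dec _ (2 * a)); [lra | reflexivity].
Qed.

Lemma ab_value_pos (a b : R) (k : Z) (x : R) :
  0 < a -> a <= b <= 2 * a ->
  IZR k * (a + b) + a <= x < IZR k * (a + b) + (a + b) ->
  ab_value a b x <> 0%nat.
Proof.
intros Ha Hb Hx; destruct (Rlt_le_dec x (IZR k * (a + b) + 2 * a)).
- rewrite (ab_value_1 a b k) by lra; lia.
- rewrite (ab_value_2 a b k) by lra; lia.
Qed.

Lemma ab_value_cases (a b x : R) :
  0 < a -> a <= b <= 2 * a ->
  exists k,
    (IZR k * (a + b) <= x < IZR k * (a + b) + a /\ ab_value a b x = 0%nat) \/
    (IZR k * (a + b) + a <= x < IZR k * (a + b) + 2 * a /\
     ab_value a b x = 1%nat) \/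
    (IZR k * (a + b) + 2 * a <= x < IZR k * (a + b) + (a + b) /\
     ab_value a b x = 2%nat).
Proof.
intros Ha Hb; assert (Hm : 0 < a + b) by lra.
destruct (remainder_spec x (a + b) Hm) as [k [E Hk]]; exists k.
destruct (Rlt_le_dec x (IZR k * (a + b) + a)).
- left; split; [lra | apply (ab_value_0 a b k); lra].
- right; destruct (Rlt_le_dec x (IZR k * (a + b) + 2 * a)).
  + left; split; [lra | apply (ab_value_1 a b k); lra].
  + right; split; [lra | apply (ab_value_2 a b k); lra].
Qed.

Lemma ab_value_add_multiple (a b x : R) (k : Z) :
  0 < a + b -> ab_value a b (x + IZR k * (a + b)) = ab_value a b x.
Proof.
intros Hm; unfold ab_value.
destruct (remainder_spec x (a + b) Hm) as [l [E Hl]].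
rewrite (remainder_unique (l + k)) by zlra; rewrite plus_IZR.
replace (x + IZR k * (a + b) - (IZR l + IZR k) * (a + b))
  with (remainder x (a + b)) by (rewrite E; ring).
reflexivity.
Qed.

(** Modulo [a + b], any two points with the same value are less than [a] apart,
    whereas the distances in [[a, b]] are at least [a] in either direction
    around the circle of length [a + b]. *)
Lemma ab_value_neq (a b s x : R) :
  0 < a -> a <= b <= 2 * a -> a <= s <= b ->
  ab_value a b (x - s) <> ab_value a b x.
Proof.
intros Ha Hb Hs.
destruct (ab_value_cases a b x Ha Hb) as [k [[H E] | [[H E] | [H E]]]];
  rewrite E.
- apply (ab_value_pos a b (k - 1)); zlra.
- destruct (Rlt_le_dec (x - s) (IZR k * (a + b))).
  + rewrite (ab_value_2 a b (k - 1)) by zlra; lia.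
  + rewrite (ab_value_0 a b k) by lra; lia.
- destruct (Rlt_le_dec (x - s) (IZR k * (a + b) + a)).
  + rewrite (ab_value_0 a b k) by lra; lia.
  + rewrite (ab_value_1 a b k) by lra; lia.
Qed.

Lemma ab_value_reach (a b x : R) (j : nat) :
  0 < a -> a <= b <= 2 * a -> 0 <= x -> (j < ab_value a b x)%nat ->
  (a <= x /\ ab_value a b (x - a) = j) \/
  (b <= x /\ ab_value a b (x - b) = j).
Proof.
intros Ha Hb Hx Hj.
destruct (ab_value_cases a b x Ha Hb) as [k [[H E] | [[H E] | [H E]]]];
  rewrite E in Hj; [lia | |];
  assert (Hk : 0 <= IZR k * (a + b))
    by (apply Rmult_le_pos; [apply IZR_le, (multiple_lt 0 k (a + b)) |]; lra).
- left; split; [lra|]; rewrite (ab_value_0 a b k) by lra; lia.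
- assert (Hj' : j = 0%nat \/ j = 1%nat) by lia; destruct Hj'; subst j.
  + right; split; [lra | apply (ab_value_0 a b k); lra].
  + left; split; [lra | apply (ab_value_1 a b k); lra].
Qed.

Lemma ab_value_start (a b x : R) :
  0 < a -> a <= b <= 2 * a -> 0 <= x < a -> ab_value a b x = 0%nat.
Proof. intros Ha Hb Hx; apply (ab_value_0 a b 0); lra. Qed.

(** If [1] lies in [[a, b]] modulo [a + b], the move [1] acts on [ab_value] like
    a move of length between [a] and [b]: it never preserves a value. *)
Lemma nim_value_green (a b : R) (N : Z) :
  0 < a -> a <= b <= 2 * a ->
  IZR N * (a + b) + a <= 1 <= IZR N * (a + b) + b ->
  nim_value [a; b; 1] (ab_value a b).
Proof.
intros Ha Hb HN x Hx; apply is_mex_options3.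
- intros _; apply ab_value_neq; lra.
- intros _; apply ab_value_neq; lra.
- intros _; rewrite <- (ab_value_add_multiple a b (x - 1) N) by lra.
  replace (x - 1 + IZR N * (a + b)) with (x - (1 - IZR N * (a + b))) by ring.
  apply ab_value_neq; lra.
- intros j Hj; destruct (ab_value_reach a b x j Ha Hb Hx Hj); auto.
Qed.

(** * Values up to 1 + a *)

Lemma is_mex_below_1 (a b x : R) (f : R -> nat) :
  0 < a -> a <= b <= 2 * a -> 0 <= x < 1 ->
  (forall y, 0 <= y < 1 -> f y = ab_value a b y) ->
  is_mex (fun v => exists y, move [a; b; 1] x y /\ v = f y) (f x).
Proof.
intros Ha Hb Hx Hf; rewrite (Hf x) by lra; apply is_mex_options3.
- intros H; rewrite Hf by lra; apply ab_value_neq; lra.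
- intros H; rewrite Hf by lra; apply ab_value_neq; lra.
- intros H; lra.
- intros j Hj.
  destruct (ab_value_reach a b x j Ha Hb (proj1 Hx) Hj) as [[H E] | [H E]].
  + left; rewrite Hf by lra; auto.
  + right; left; rewrite Hf by lra; auto.
Qed.

(** Outside the green regions, [1] lies beyond [b] modulo [a + b] but before
    the end of the next block of zeros.  On [[1, 1 + a)] the move [1] then
    contributes the value [0], and the moves [a] and [b] contribute the two
    values compared here: the mex is the value at [x - a] plus one. *)
Lemma ab_value_after_1 (a b x : R) (N : Z) :
  0 < a -> a <= b <= 2 * a ->
  IZR N * (a + b) + b < 1 < IZR N * (a + b) + (a + b) + a ->
  1 <= x < 1 + a ->
  ab_value a b (x - b) <> S (ab_value a b (x - a)) /\
  (ab_value a b (x - a) = 2%nat -> ab_value a b (x - b) = 1%nat).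
Proof.
intros Ha Hb HN Hx.
destruct (Rlt_le_dec (x - a) (IZR N * (a + b) + a)).
{ rewrite (ab_value_0 a b N (x - a)), (ab_value_0 a b N (x - b)) by lra; lia. }
destruct (Rlt_le_dec (x - a) (IZR N * (a + b) + 2 * a)).
{ rewrite (ab_value_1 a b N (x - a)) by lra.
  destruct (Rlt_le_dec (x - b) (IZR N * (a + b) + a)).
  - rewrite (ab_value_0 a b N) by lra; lia.
  - rewrite (ab_value_1 a b N) by lra; lia. }
destruct (Rlt_le_dec (x - a) (IZR N * (a + b) + (a + b))).
{ rewrite (ab_value_2 a b N (x - a)), (ab_value_1 a b N (x - b)) by lra; lia. }
rewrite (ab_value_0 a b (N + 1) (x - a)) by zlra.
destruct (Rlt_le_dec (x - b) (IZR N * (a + b) + (a + b))).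
- rewrite (ab_value_2 a b N) by lra; lia.
- rewrite (ab_value_0 a b (N + 1)) by zlra; lia.
Qed.

Lemma is_mex_after_1 (a b x : R) (N : Z) (f : R -> nat) :
  0 < a -> a <= b <= 2 * a -> b < 1 ->
  IZR N * (a + b) + b < 1 < IZR N * (a + b) + (a + b) + a ->
  1 <= x < 1 + a ->
  (forall y, 0 <= y < 1 -> f y = ab_value a b y) ->
  f x = S (ab_value a b (x - a)) ->
  is_mex (fun v => exists y, move [a; b; 1] x y /\ v = f y) (f x).
Proof.
intros Ha Hb Hb1 HN Hx Hf E; rewrite E.
destruct (ab_value_after_1 a b x N Ha Hb HN Hx) as [H1 H2].
assert (H0 : f (x - 1) = 0%nat)
  by (rewrite Hf by lra; apply ab_value_start; lra).
rewrite <- (Hf (x - a)), <- (Hf (x - b)) in H1, H2 by lra.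
rewrite <- (Hf (x - a)) by lra.
assert (H3 : (f (x - a)%R <= 2)%nat).
{ rewrite Hf by lra.
  destruct (ab_value_cases a b (x - a) Ha Hb) as [k [[_ Q] | [[_ Q] | [_ Q]]]];
    rewrite Q; lia. }
apply is_mex_options3; intros; try (rewrite ?H0; lia).
destruct j as [|[|j]].
- right; right; split; [lra | auto].
- destruct (Nat.eq_dec (f (x - a)) 1).
  + left; split; [lra | auto].
  + right; left; split; [lra | apply H2; lia].
- left; split; [lra | lia].
Qed.

(** * Red and blue regions *)

(** Gives the Nim values on [[0, 1 + a)] for all colors but green; for red this
    is a full period. *)
Definition red_value (a b x : R) : nat :=
  if Rlt_dec x 1 then ab_value a b x else S (ab_value a b (x - a)).

Lemma red_value_lt (a b x : R) : x < 1 -> red_value a b x = ab_value a b x.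
Proof. intros H; unfold red_value; destruct (Rlt_dec x 1); [auto | lra]. Qed.

Lemma red_value_ge (a b x : R) :
  1 <= x -> red_value a b x = S (ab_value a b (x - a)).
Proof. intros H; unfold red_value; destruct (Rlt_dec x 1); [lra | auto]. Qed.

Lemma nim_value_red (a b : R) (N : Z) :
  0 < a -> a <= b <= 2 * a -> b < 1 ->
  IZR N * (a + b) + b < 1 <= IZR N * (a + b) + (a + b) ->
  nim_value [a; b; 1] (fun x => red_value a b (remainder x (a + 1))).
Proof.
intros Ha Hb Hb1 HN; apply nim_value_periodic_extension; [lra | | |].
- intros s [E | [E | [E | []]]]; subst; lra.
- intros t Ht; destruct (Rlt_le_dec t 1).
  + apply is_mex_below_1; try lra; intros; apply red_value_lt; lra.
  + apply (is_mex_after_1 a b t N); try lra.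
    * intros; apply red_value_lt; lra.
    * apply red_value_ge; lra.
- intros t s [E | [E | [E | []]]] Ht; subst s.
  + rewrite red_value_ge, (red_value_lt a b t), (ab_value_start a b t) by lra.
    lia.
  + rewrite (red_value_lt a b t) by lra.
    destruct (Rlt_le_dec (t - b + (a + 1)) 1).
    * rewrite red_value_lt, (ab_value_start a b t) by lra.
      apply (ab_value_pos a b N); lra.
    * rewrite red_value_ge by lra; destruct (Rlt_le_dec t a).
      { rewrite (ab_value_start a b t) by lra; lia. }
      rewrite (ab_value_1 a b 0 t) by lra.
      assert (ab_value a b (t - b + (a + 1) - a) <> 0%nat)
        by (apply (ab_value_pos a b N); lra); lia.
  + rewrite (red_value_lt a b t) by lra.
    destruct (Rlt_le_dec (t - 1 + (a + 1)) 1).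
    * rewrite red_value_lt by lra; intros E.
      apply (ab_value_neq a b a (t - 1 + (a + 1)) Ha Hb); [lra|].
      rewrite E; f_equal; ring.
    * rewrite red_value_ge by lra.
      replace (t - 1 + (a + 1) - a) with t by ring; lia.
Qed.

(** On [[1 + a, 1 + b)] the moves [1] and [b] lead to the values [1] and [0], so
    the value is [2] unless the move [a], which leads back into
    [[1, 1 + a)], reaches [2] as well. *)
Definition blue_value (a b x : R) : nat :=
  if Rlt_dec x (1 + a) then red_value a b x
  else if Nat.eq_dec (ab_value a b (x - 2 * a)) 1 then 3 else 2.

Lemma blue_value_lt (a b x : R) :
  0 < a -> x < 1 -> blue_value a b x = ab_value a b x.
Proof.
intros Ha H; unfold blue_value; destruct (Rlt_dec x (1 + a)); [|lra].
apply red_value_lt; lra.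
Qed.

Lemma blue_value_mid (a b x : R) :
  1 <= x < 1 + a -> blue_value a b x = S (ab_value a b (x - a)).
Proof.
intros H; unfold blue_value; destruct (Rlt_dec x (1 + a)); [|lra].
apply red_value_ge; lra.
Qed.

Lemma blue_value_ge (a b x : R) :
  1 + a <= x ->
  (ab_value a b (x - 2 * a) = 1%nat /\ blue_value a b x = 3%nat) \/
  (ab_value a b (x - 2 * a) <> 1%nat /\ blue_value a b x = 2%nat).
Proof.
intros H; unfold blue_value; destruct (Rlt_dec x (1 + a)); [lra|].
destruct (Nat.eq_dec _ 1); auto.
Qed.

Lemma blue_value_pos (a b x : R) : 1 <= x -> blue_value a b x <> 0%nat.
Proof.
intros H; destruct (Rlt_le_dec x (1 + a)).
- rewrite blue_value_mid by lra; lia.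
- destruct (blue_value_ge a b x) as [[_ E] | [_ E]]; lra || lia.
Qed.

Lemma nim_value_blue (a b : R) (N : Z) :
  0 < a -> a <= b <= 2 * a -> b < 1 ->
  IZR N * (a + b) < 1 ->
  IZR N * (a + b) + (b - a) <= 1 < IZR N * (a + b) + a ->
  nim_value [a; b; 1] (fun x => blue_value a b (remainder x (b + 1))).
Proof.
intros Ha Hb Hb1 HN0 HN.
assert (HN1 : IZR (N - 1) * (a + b) + b < 1
              < IZR (N - 1) * (a + b) + (a + b) + a) by zlra.
(* These [x - b] lie in the block of zeros that also contains [1]. *)
assert (Hb0 : forall x, 1 + a <= x < 1 + b -> ab_value a b (x - b) = 0%nat)
  by (intros x Hx; apply (ab_value_0 a b N); lra).
apply nim_value_periodic_extension; [lra | | |].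
- intros s [E | [E | [E | []]]]; subst; lra.
- intros t Ht; destruct (Rlt_le_dec t 1).
  { apply is_mex_below_1; try lra; intros; apply blue_value_lt; lra. }
  destruct (Rlt_le_dec t (1 + a)).
  { apply (is_mex_after_1 a b t (N - 1)); try lra.
    - intros; apply blue_value_lt; lra.
    - apply blue_value_mid; lra. }
  assert (E1 : blue_value a b (t - 1) = 1%nat)
    by (rewrite blue_value_lt by lra; apply (ab_value_1 a b 0); lra).
  assert (Eb : blue_value a b (t - b) = 0%nat)
    by (rewrite blue_value_lt by lra; apply Hb0; lra).
  assert (Ea : blue_value a b (t - a) = S (ab_value a b (t - 2 * a)))
    by (rewrite blue_value_mid by lra; do 2 f_equal; ring).
  destruct (blue_value_ge a b t) as [[V E] | [V E]]; [lra | |]; rewrite E;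
    apply is_mex_options3; intros; rewrite ?E1, ?Eb, ?Ea in *; try lia;
    destruct j as [|[|[|j]]]; try lia;
    (right; left; split; [lra | reflexivity]) ||
    (right; right; split; [lra | reflexivity]) ||
    (left; split; [lra | lia]).
- intros t s [E | [E | [E | []]]] Ht; subst s.
  + rewrite (blue_value_lt a b t), (ab_value_start a b t) by lra.
    apply blue_value_pos; lra.
  + rewrite (blue_value_lt a b t) by lra; destruct (Rlt_le_dec t a).
    * rewrite (ab_value_start a b t) by lra; apply blue_value_pos; lra.
    * rewrite (ab_value_1 a b 0 t) by lra.
      destruct (blue_value_ge a b (t - b + (b + 1))) as [[_ E] | [_ E]];
        lra || lia.
  + rewrite (blue_value_lt a b t) by lra.
    replace (t - 1 + (b + 1)) with (t + b) by ring.
    assert (Et : ab_value a b t = ab_value a b (t + b - b))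
      by (f_equal; ring).
    destruct (Rlt_le_dec (t + b) 1).
    { rewrite blue_value_lt, Et by lra; intros E; symmetry in E; revert E.
      apply ab_value_neq; lra. }
    destruct (Rlt_le_dec (t + b) (1 + a)).
    * rewrite blue_value_mid, Et by lra.
      destruct (ab_value_after_1 a b (t + b) (N - 1)); auto; lra.
    * rewrite Et, Hb0 by lra; apply blue_value_pos; lra.
Qed.

(** * Minimality of the periods *)

(** A period [q < p] moves [0] to a zero of [f], hence into a block of zeros of
    [ab_value].  Unless [q] is the start of that block, some point of the
    initial block [[0, a)] is moved to the end of the block, where [f] is not
    zero. *)
Lemma period_is_multiple (a b c p q : R) (f : R -> nat) :
  0 < a -> a <= b <= 2 * a -> a <= c -> c + a <= p ->
  (forall x, 0 <= x < c -> f x = ab_value a b x) ->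
  (forall x, c <= x < p -> f x <> 0%nat) ->
  pure_period f q -> q < p ->
  q < c /\ exists k, q = IZR k * (a + b).
Proof.
intros Ha Hb Hac Hcp Hf Hpos [Hq Hper] Hqp.
assert (Hstart : forall x, 0 <= x < a -> f x = 0%nat)
  by (intros x Hx; rewrite Hf by lra; apply ab_value_start; lra).
assert (Hfq : f q = 0%nat).
{ rewrite <- (Rplus_0_l q), Hper by lra; apply Hstart; lra. }
assert (Hqc : q < c).
{ destruct (Rlt_le_dec q c); [auto|]; destruct (Hpos q); auto; lra. }
split; [exact Hqc|].
destruct (ab_value_cases a b q Ha Hb) as [k [[H E] | [[_ E] | [_ E]]]];
  [|rewrite Hf in Hfq by lra; congruence..].
exists k; destruct (Rle_lt_dec q (IZR k * (a + b))); [lra|exfalso].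
assert (Hend : f (IZR k * (a + b) + a) = 0%nat).
{ replace (IZR k * (a + b) + a) with (a - (q - IZR k * (a + b)) + q) by ring.
  rewrite Hper by lra; apply Hstart; lra. }
destruct (Rlt_le_dec (IZR k * (a + b) + a) c).
- revert Hend; rewrite Hf by lra; apply (ab_value_pos a b k); lra.
- revert Hend; apply Hpos; lra.
Qed.

(** A point [z] in [[1, 1 + a)] where [ab_value] vanishes but [f] does not
    rules out all multiples of [a + b]: such a period moves [z] below [1],
    where [f] is [ab_value]. *)
Lemma multiple_not_period (a b q z : R) (f : R -> nat) (j k : Z) :
  0 < a -> a <= b <= 2 * a -> q < 1 -> 1 <= z < 1 + a ->
  (forall x, 0 <= x < 1 -> f x = ab_value a b x) ->
  f z <> 0%nat ->
  IZR j * (a + b) <= z < IZR j * (a + b) + a ->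
  q = IZR k * (a + b) -> ~ pure_period f q.
Proof.
intros Ha Hb Hq1 Hz Hf Hfz Hj Hk [Hq Hper]; apply Hfz.
assert (1 <= IZR k).
{ apply IZR_le, (Zlt_le_succ 0), lt_IZR.
  apply Rmult_lt_reg_r with (a + b); lra. }
assert (a + b <= q) by (subst q; apply Rle_trans with (1 * (a + b));
  [lra | apply Rmult_le_compat_r; lra]).
replace z with (z - q + q) by ring; rewrite Hper, Hf by lra.
apply (ab_value_0 a b (j - k)); zlra.
Qed.

(** Instances: for red, [z] is the multiple of [a + b] in [[1, 1 + a)]; for blue,
    [z = 1]. *)
Lemma min_pure_period_after_1 (a b p z : R) (f : R -> nat) (j : Z) :
  0 < a -> a <= b <= 2 * a -> a < 1 -> 1 + a <= p -> 1 <= z < 1 + a ->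
  (forall x, 0 <= x < 1 -> f x = ab_value a b x) ->
  (forall x, 1 <= x < p -> f x <> 0%nat) ->
  IZR j * (a + b) <= z < IZR j * (a + b) + a ->
  pure_period f p -> purely_periodic f /\ min_pure_period f p.
Proof.
intros Ha Hb Ha1 Hp Hz Hf Hpos Hj Hper; split; [exists p; auto|].
split; [auto|]; intros q Hq; destruct (Rle_lt_dec p q) as [|Hqp]; [auto|].
exfalso.
destruct (period_is_multiple a b 1 p q f) as [Hq1 [k Hk]]; auto; try lra.
apply (multiple_not_period a b q z f j k); auto; apply Hpos; lra.
Qed.

Lemma pure_period_of_remainder (g F : R -> nat) (p : R) :
  0 < p -> (forall x, 0 <= x -> g x = F (remainder x p)) -> pure_period g p.
Proof.
intros Hp H; split; [auto|]; intros x Hx.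
rewrite !H, remainder_add_period by lra; reflexivity.
Qed.

Lemma moves_pos (a b s : R) : 0 < a -> 0 < b -> In s [a; b; 1] -> 0 < s.
Proof. intros Ha Hb [E | [E | [E | []]]]; subst; lra. Qed.

Lemma green_period (a b : R) (g : R -> nat) (N : Z) :
  0 < a -> a <= b <= 2 * a -> nim_value [a; b; 1] g ->
  IZR N * (a + b) + a <= 1 <= IZR N * (a + b) + b ->
  purely_periodic g /\ min_pure_period g (a + b).
Proof.
intros Ha Hb Hg HN.
assert (Hgh : forall x, 0 <= x -> g x = ab_value a b x).
{ apply (nim_value_unique [a; b; 1]); auto.
  - intros s; apply moves_pos; lra.
  - apply (nim_value_green a b N); auto. }
assert (Hper : pure_period g (a + b)).
{ split; [lra|]; intros x Hx; rewrite !Hgh by lra.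
  replace (x + (a + b)) with (x + IZR 1 * (a + b)) by ring.
  apply ab_value_add_multiple; lra. }
split; [exists (a + b); auto|]; split; [auto|].
intros q Hq; destruct (Rle_lt_dec (a + b) q) as [|Hqm]; [auto|exfalso].
destruct (period_is_multiple a b a (a + b) q g) as [Hqa [k Hk]]; auto; try lra.
- intros; apply Hgh; lra.
- intros; rewrite Hgh by lra; apply (ab_value_pos a b 0); lra.
- destruct Hq as [Hq _].
  assert (k <= 0)%Z by (apply (multiple_lt k 0 (a + b)); lra).
  assert (0 < k)%Z by (apply lt_IZR, Rmult_lt_reg_r with (a + b); lra).
  lia.
Qed.

Lemma red_period (a b : R) (g : R -> nat) (N : Z) :
  0 < a -> a <= b <= 2 * a -> b < 1 -> nim_value [a; b; 1] g ->
  IZR N * (a + b) + b < 1 <= IZR N * (a + b) + (a + b) ->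
  purely_periodic g /\ min_pure_period g (a + 1).
Proof.
intros Ha Hb Hb1 Hg HN.
assert (Hgf : forall x, 0 <= x -> g x = red_value a b (remainder x (a + 1))).
{ apply (nim_value_unique [a; b; 1]); auto.
  - intros s; apply moves_pos; lra.
  - apply (nim_value_red a b N); auto. }
apply (min_pure_period_after_1 a b _ (IZR (N + 1) * (a + b)) g (N + 1));
  try zlra.
- intros x Hx; rewrite Hgf, remainder_small by lra; apply red_value_lt; lra.
- intros x Hx; rewrite Hgf, remainder_small, red_value_ge by lra; lia.
- apply pure_period_of_remainder with (red_value a b); auto; lra.
Qed.

Lemma blue_period (a b : R) (g : R -> nat) (N : Z) :
  0 < a -> a <= b <= 2 * a -> b < 1 -> nim_value [a; b; 1] g ->
  IZR N * (a + b) < 1 ->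
  IZR N * (a + b) + (b - a) <= 1 < IZR N * (a + b) + a ->
  purely_periodic g /\ min_pure_period g (b + 1).
Proof.
intros Ha Hb Hb1 Hg HN0 HN.
assert (Hgf : forall x, 0 <= x -> g x = blue_value a b (remainder x (b + 1))).
{ apply (nim_value_unique [a; b; 1]); auto.
  - intros s; apply moves_pos; lra.
  - apply (nim_value_blue a b N); auto. }
apply (min_pure_period_after_1 a b _ 1 g N); try lra.
- intros x Hx; rewrite Hgf, remainder_small by lra; apply blue_value_lt; lra.
- intros x Hx; rewrite Hgf, remainder_small by lra; apply blue_value_pos; lra.
- apply pure_period_of_remainder with (blue_value a b); auto; lra.
Qed.

(** * White regions *)

(** [a + b] fails because [1 - (a + b)] lies in a block of zeros while the move
    from [1] to [0] makes [g 1] positive.  For [1 + a], the number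
    [N * (a + b) + b - (1 + a)] lies in [[0, a)], so its value is [0]; after
    adding [1 + a], the move [b] leads to [N * (a + b)], whose value is [0].
    For [1 + b], the position [1 + a] has value [0], as its options have the
    positive values [g 1], [2] and [1].  The move [a] leads to it from
    [(2 * a - b) + (1 + b)], whereas [g (2 * a - b) = 0]. *)
Lemma white_not_period (a b : R) (g : R -> nat) (N : Z) :
  0 < a -> a <= b <= 2 * a -> b < 1 -> nim_value [a; b; 1] g ->
  IZR N * (a + b) < 1 < IZR N * (a + b) + (b - a) -> a + b < 1 ->
  ~ pure_period g (a + b) /\ ~ pure_period g (1 + a) /\
  ~ pure_period g (1 + b).
Proof.
intros Ha Hb Hb1 Hg HN Hm.
assert (Hgh : forall x, 0 <= x < 1 -> g x = ab_value a b x).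
{ apply (nim_value_unique_below [a; b; 1]); auto.
  - intros s; apply moves_pos; lra.
  - intros x Hx; pose proof (is_mex_below_1 a b x (ab_value a b)); auto. }
assert (Hneq : forall x s, In s [a; b; 1] -> s <= x -> g (x - s) <> g x).
{ intros x s Hs Hx; pose proof (moves_pos a b s).
  apply (nim_value_move_neq [a; b; 1]); auto.
  split; [apply Rlt_le, H; auto; lra | lra]. }
assert (Hstart : forall x, 0 <= x < a -> g x = 0%nat)
  by (intros x Hx; rewrite Hgh by lra; apply ab_value_start; lra).
assert (H1 : g 1 <> 0%nat).
{ rewrite <- (Hstart (1 - 1)) by lra; intros E.
  apply (Hneq 1 1); simpl; auto; lra. }
split; [|split].
- apply (multiple_not_period a b _ 1 g N 1); auto; lra.
- intros [_ Hper]; set (x := IZR N * (a + b) + b - (1 + a)).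
  assert (E : g (x + (1 + a)) = 0%nat)
    by (rewrite Hper by (unfold x; lra); apply Hstart; unfold x; lra).
  apply (Hneq (x + (1 + a)) b); [simpl; auto | unfold x; lra | rewrite E].
  rewrite Hgh by (unfold x; lra); apply (ab_value_0 a b N); unfold x; lra.
- intros [_ Hper].
  assert (Ea : g (1 + a) = 0%nat).
  { assert (H0 : 0 <= 1 + a) by lra.
    apply (is_mex_unique _ _ _ (Hg (1 + a) H0)).
    apply is_mex_options3; intros; try lia.
    - replace (1 + a - a) with 1 by ring; auto.
    - rewrite Hgh by lra; apply (ab_value_pos a b (N - 1)); zlra.
    - rewrite Hgh by lra; apply (ab_value_pos a b 0); lra. }
  apply (Hneq (1 + 2 * a) a); [simpl; auto | lra|].
  replace (1 + 2 * a - a) with (1 + a) by ring; rewrite Ea.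
  replace (1 + 2 * a) with (2 * a - b + (1 + b)) by ring.
  rewrite Hper, Hstart by lra; reflexivity.
Qed.

(** * Splitting of the regions and the remainder of 1 - a *)

Lemma white_split (a b : R) (n : nat) :
  white n a b <->
  white1 n a b \/ white2 n a b \/ white3 n a b \/ white4 n a b.
Proof.
split; [|intros [[H _] | [[H _] | [[H _] | [H _]]]]; exact H].
intros H; pose proof H as [_ H'].
destruct (Rle_lt_dec 1 ((INR n + 3) * a + (INR n - 2) * b)).
- left; split; [exact H | split; [|apply Rmin_glb]; lra].
- right; left; split; [exact H | lra].
Qed.

Lemma blue_split (a b : R) (n : nat) :
  blue n a b <-> blue1 n a b \/ blue2 n a b \/ blue3 n a b.
Proof.
split; [|intros [[H _] | [[H _] | [H _]]]; exact H].
intros H; pose proof H as [_ H'].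
destruct (Rlt_le_dec 1 ((INR n + 3) * a + (INR n - 2) * b)).
- left; split; [exact H | lra].
- destruct (Rlt_le_dec 1 ((INR n + 2) * a + (INR n - 1) * b)); right.
  + left; split; [exact H | split; [apply Rmax_lub|]; lra].
  + right; split; [exact H | split; [apply Rmax_lub|]; lra].
Qed.


Lemma level_remainder (a b : R) (n : nat) :
  0 < a < 1 -> a <= b -> level n a b ->
  (INR n * (a + b) + a <= 1 /\
   remainder (1 - a) (a + b) = 1 - a - INR n * (a + b)) \/
  (1 < INR n * (a + b) + a /\
   remainder (1 - a) (a + b) = 1 - a - INR n * (a + b) + (a + b)).
Proof.
intros Ha Hb [H1 H2]; rewrite INR_IZR_INZ in *.
destruct (Rle_lt_dec (IZR (Z.of_nat n) * (a + b) + a) 1); [left | right];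
  (split; [lra|]).
- rewrite (remainder_unique (Z.of_nat n)); lra.
- rewrite (remainder_unique (Z.of_nat n - 1)); zlra.
Qed.

(** Supplies the requirement [1 <= n] of the green, white and blue regions, which
    the conditions on the remainder imply only through [b < 1]. *)
Lemma level_pos (a b : R) (n : nat) :
  b < 1 -> 1 <= INR n * (a + b) + b -> (1 <= n)%nat.
Proof. intros Hb H; destruct n; [simpl in H; lra | lia]. Qed.

Theorem theorem3 (a b : R) (g : R -> nat) (n : nat)
  (ha : 0 < a < 1) (hb : 0 < b < 1) (hba : b <= 2 * a) (hab : a <= 2 * b)
  (hg : nim_value [a; b; 1] g) (hle : a <= b) (hn : level n a b) :
  (* periods *)
  (green n a b -> purely_periodic g /\ min_pure_period g (a + b)) /\
  (red n a b -> purely_periodic g /\ min_pure_period g (a + 1)) /\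
  (blue n a b -> purely_periodic g /\ min_pure_period g (b + 1)) /\
  (white n a b ->
     ~ pure_period g (a + b) /\ ~ pure_period g (1 + a) /\
     ~ pure_period g (1 + b)) /\
  (* splitting of the regions *)
  (red n a b <-> red1 n a b \/ red2 n a b) /\
  ~ (red1 n a b /\ red2 n a b) /\
  (white n a b <->
     white1 n a b \/ white2 n a b \/ white3 n a b \/ white4 n a b) /\
  ~ (white1 n a b /\ white2 n a b) /\
  ~ (white1 n a b /\ white3 n a b) /\
  ~ (white1 n a b /\ white4 n a b) /\
  ~ (white3 n a b /\ white4 n a b) /\
  (blue n a b <-> blue1 n a b \/ blue2 n a b \/ blue3 n a b) /\
  ~ (blue1 n a b /\ blue2 n a b) /\
  ~ (blue1 n a b /\ blue3 n a b) /\
  ~ (blue2 n a b /\ blue3 n a b) /\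
  (* the remainder determines the region *)
  (let m := a + b in
   let lambda := remainder (1 - a) m in
   (green n a b <-> 0 <= lambda <= b - a) /\
   (red1 n a b <-> b - a < lambda <= a) /\
   (red2 n a b <-> a < lambda <= b) /\
   (white n a b <->
      b < lambda /\
      (b < lambda < Rmin (2 * b - a) (3 * a - b) \/
       3 * a - b <= lambda < 2 * b - a \/
       (b < lambda < 2 * a /\ 2 * a < 2 * b - a) \/
       2 * a <= lambda < 2 * b - a)) /\
   (lambda <> 3 * a - b ->
      (white1 n a b <-> b < lambda < Rmin (2 * b - a) (3 * a - b)) /\
      (white2 n a b <-> b < lambda /\ 3 * a - b <= lambda < 2 * b - a)) /\
   (lambda <> 2 * a ->
      (white3 n a b <-> b < lambda < 2 * a /\ 2 * a < 2 * b - a) /\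
      (white4 n a b <-> 2 * a <= lambda < 2 * b - a)) /\
   (blue1 n a b <-> b < lambda /\ 2 * b - a <= lambda < 3 * a - b) /\
   (blue2 n a b <-> Rmax (2 * b - a) (3 * a - b) <= lambda < 2 * a) /\
   (blue3 n a b <-> Rmax (2 * b - a) (2 * a) <= lambda < m)).
Proof.
assert (Hb : a <= b <= 2 * a) by lra.
assert (HN := INR_IZR_INZ n).
assert (Hpos := level_pos a b n (proj2 hb)).
assert (Hlam := level_remainder a b n ha hle hn).
destruct hn as [hn1 hn2].
split; [|split; [|split; [|split]]].
- intros [_ H]; rewrite HN in *; apply (green_period a b g (Z.of_nat n)); auto; lra.
- intros H; unfold red in H; rewrite HN in *.
  apply (red_period a b g (Z.of_nat n)); auto; lra.
- intros [_ H]; rewrite HN in *; apply (blue_period a b g (Z.of_nat n)); auto; lra.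
- intros [Hn H]; apply le_INR in Hn; simpl in Hn.
  assert (1 * (a + b) <= INR n * (a + b)) by (apply Rmult_le_compat_r; lra).
  rewrite HN in *; apply (white_not_period a b g (Z.of_nat n)); auto; lra.
- cbv zeta; set (l := remainder (1 - a) (a + b)) in *; clearbody l.
  clear HN hg g.
  repeat match goal with |- _ /\ _ => split end;
    try exact (white_split a b n); try exact (blue_split a b n).
  all: unfold red1, red2, white1, white2, white3, white4, blue1, blue2, blue3,
    green, red, white, blue, Rmin, Rmax.
  all: assert (Hn : (1 <= n)%nat \/ INR n * (a + b) + b < 1)
    by (destruct (Rlt_le_dec (INR n * (a + b) + b) 1); auto).
  all: clear Hpos; intros; destruct Hlam as [[L1 L2] | [L1 L2]], Hn.
  all: repeat destruct Rle_dec; intuition lra.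
Qed.
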